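(* Let $k\geq 2$ and let $L=(l_1,\dots,l_k)$ be positive integers with $l_1+\dots+l_k=n$ which are generic and reduced. Then the geometric realization of the generalized tonnetz $Tonn^{n,k}(L)$ is homeomorphic to the $(k-1)$-dimensional torus $T^{k-1}=(S^1)^{k-1}$, i.e. $Tonn^{n,k}(L)$ is a triangulation of $T^{k-1}$.
   Context: Elements of $[n]$ are identified with elements of $\mathbb{Z}_n$. $L=(l_1,\dots,l_k)$ is generic if for all subsets $I,J\subseteq[k]$, $\sum_{i\in I}l_i=\sum_{j\in J}l_j$ implies $I=J$. $L$ is reduced if $\gcd(l_1,\dots,l_k)=1$. The generalized tonnetz $Tonn^{n,k}(L)$ is the simplicial complex on vertex set $\mathbb{Z}_n$ whose maximal simplices are the sets $\Delta(x;\sigma)=\{x,\,x+l_{\sigma(1)},\,x+l_{\sigma(1)}+l_{\sigma(2)},\dots,x+l_{\sigma(1)}+\dots+l_{\sigma(k-1)}\}$ (sums in $\mathbb{Z}_n$), for $x\in\mathbb{Z}_n$ and $\sigma\in S_k$; its simplices are all subsets of these sets. *)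

(* Defs.v *)
From Stdlib Require Import Reals List Permutation Arith.
Import ListNotations.
Open Scope R_scope.

(* l_i for i in {0,...,k-1} (0-based indexing of L = [l_1; ...; l_k]) *)
Definition lval (L : list nat) (i : nat) : nat := nth i L 0%nat.

Definition subsum (L : list nat) (I : nat -> bool) : nat :=
  list_sum (map (fun i => if I i then lval L i else 0%nat) (seq 0 (length L))).

Definition generic (L : list nat) : Prop :=
  forall I J : nat -> bool, subsum L I = subsum L J ->
    forall i, (i < length L)%nat -> I i = J i.

Definition reduced (L : list nat) : Prop := fold_right Nat.gcd 0%nat L = 1%nat.

(* l_{sigma(1)} + ... + l_{sigma(j)}, sigma given as the list [sigma(1);...;sigma(k)]
   (a permutation of [0;...;k-1]) *)
Definition psum (L : list nat) (s : list nat) (j : nat) : nat :=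
  list_sum (map (lval L) (firstn j s)).

Definition tonn_max_simplex (n : nat) (L : list nat) (x : nat) (s : list nat)
  : list nat :=
  map (fun j => ((x + psum L s j) mod n)%nat) (seq 0 (length L)).

Definition tonn_simplex (n : nat) (L : list nat) (S : nat -> Prop) : Prop :=
  exists x s, (x < n)%nat /\ Permutation s (seq 0 (length L)) /\
    forall v, S v -> In v (tonn_max_simplex n L x s).

(* Geometric realization of Tonn^{n,k}(L) inside R^n (= functions nat -> R
   vanishing from coordinate n on), vertex v ↦ standard basis vector e_v:
   points are barycentric coordinate vectors whose support is a simplex. *)
Definition tonn_realization (n : nat) (L : list nat) (p : nat -> R) : Prop :=
  (forall v, 0 <= p v) /\
  (forall v, (n <= v)%nat -> p v = 0) /\
  fold_right Rplus 0 (map p (seq 0 n)) = 1 /\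
  tonn_simplex n L (fun v => p v <> 0).

(* The torus (S^1)^d inside R^{2d}: coordinates (t_{2i}, t_{2i+1}) on the unit circle *)
Definition torus (d : nat) (t : nat -> R) : Prop :=
  (forall i, (i < d)%nat -> t (2 * i)%nat ^ 2 + t (2 * i + 1)%nat ^ 2 = 1) /\
  (forall j, (2 * d <= j)%nat -> t j = 0).

Definition continuous_on (m1 m2 : nat) (A : (nat -> R) -> Prop)
  (f : (nat -> R) -> (nat -> R)) : Prop :=
  forall p, A p -> forall eps, 0 < eps -> exists delta, 0 < delta /\
    forall q, A q -> (forall i, (i < m1)%nat -> Rabs (q i - p i) < delta) ->
      forall j, (j < m2)%nat -> Rabs (f q j - f p j) < eps.

Definition homeomorphic (m1 m2 : nat) (A B : (nat -> R) -> Prop) : Prop :=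
  exists f g : (nat -> R) -> (nat -> R),
    (forall p, A p -> B (f p)) /\
    (forall q, B q -> A (g q)) /\
    (forall p, A p -> forall i, g (f p) i = p i) /\
    (forall q, B q -> forall i, f (g q) i = q i) /\
    continuous_on m1 m2 A f /\
    continuous_on m2 m1 B g.

(* Main.v *)
Require Import Defs.
From Stdlib Require Import Reals List Permutation Arith.
From Stdlib Require Import Lra Lia ZArith Sorted ClassicalEpsilon.
Import ListNotations.
Local Open Scope R_scope.

(** Let [K] be the lattice of the [x] in Z^k with [l.x] in [nZ], taken modulo the
    diagonal [(1,...,1)].  Sending [x] to [l.x mod n] identifies the tonnetz with the
    quotient by [K] of the Coxeter triangulation of [V = R^k / R(1,...,1)], whose
    simplices are [{X, X + e_s(1), X + e_s(1) + e_s(2), ...}]; and [V / K] is a torus: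
    as [gcd L = 1], the vector [L] is the first row of a matrix of GL_k(Z), whose other
    rows give coordinates on [V / K].

    Genericity recovers from the residue [v - b mod n] of two vertices of a simplex the
    set of steps leading from [b] to [v], so a point with barycentric coordinates [p]
    lifts affinely to R^k once a base vertex [b] is chosen.  Changing [b] changes the
    lift by an element of [K] and a multiple of [(1,...,1)], so the map to [V / K] is
    well defined and, keeping [b] fixed near [p], continuous.  It is surjective: sorting
    the fractional parts of [h] yields a simplex containing [h].  It is injective: for
    any lift [h] of [p] and any [w] in Z^k with [l.w = v mod n], the coordinate [p v] is
    at least [1 - (max - min)(h - w)], with equality when [w] is suitably chosen.
    The same inequality applied to two points with nearby images bounds the distance
    between them, so the inverse map is uniformly continuous. *)

(** * Finite sums and integer points *)

Definition rsum (d : nat) (F : nat -> R) : R :=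
  fold_right Rplus 0 (map F (seq 0 d)).

Lemma rsum_S (d : nat) (F : nat -> R) :
  rsum (S d) F = F 0%nat + rsum d (fun i => F (S i)).
Proof.
  unfold rsum; cbn [seq map fold_right]; now rewrite <- seq_shift, map_map.
Qed.

Lemma rsum_pred (d : nat) (F : nat -> R) :
  (0 < d)%nat -> rsum d F = F 0%nat + rsum (d - 1) (fun i => F (S i)).
Proof.
  destruct d as [|d]; [lia|]; intros _; rewrite rsum_S; cbn [Nat.sub].
  now rewrite Nat.sub_0_r.
Qed.

Lemma rsum_ext (d : nat) (F G : nat -> R) :
  (forall i, (i < d)%nat -> F i = G i) -> rsum d F = rsum d G.
Proof.
  intros HFG; unfold rsum; f_equal; apply map_ext_in.
  intros i Hi; apply in_seq in Hi; apply HFG; lia.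
Qed.

Lemma rsum_plus (d : nat) (F G : nat -> R) :
  rsum d (fun i => F i + G i) = rsum d F + rsum d G.
Proof.
  revert F G; induction d as [|d IH]; intros F G; [cbn; ring|].
  rewrite !rsum_S, IH; ring.
Qed.

Lemma rsum_scal (d : nat) (a : R) (F : nat -> R) :
  rsum d (fun i => a * F i) = a * rsum d F.
Proof.
  revert F; induction d as [|d IH]; intros F; [cbn; ring|].
  rewrite !rsum_S, IH; ring.
Qed.

Lemma rsum_minus (d : nat) (F G : nat -> R) :
  rsum d (fun i => F i - G i) = rsum d F - rsum d G.
Proof.
  rewrite (rsum_ext d _ (fun i => F i + -1 * G i)) by (intros; ring).
  rewrite rsum_plus, rsum_scal; ring.
Qed.

Lemma rsum_zero (d : nat) : rsum d (fun _ => 0) = 0.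
Proof. induction d as [|d IH]; [reflexivity|]; rewrite rsum_S, IH; ring. Qed.

Lemma rsum_swap (d e : nat) (F : nat -> nat -> R) :
  rsum d (fun i => rsum e (fun j => F i j)) =
  rsum e (fun j => rsum d (fun i => F i j)).
Proof.
  revert F; induction d as [|d IH]; intros F; [symmetry; apply rsum_zero|].
  rewrite rsum_S, IH, <- rsum_plus.
  apply rsum_ext; intros; now rewrite rsum_S.
Qed.

Lemma rsum_le (d : nat) (F G : nat -> R) :
  (forall i, (i < d)%nat -> F i <= G i) -> rsum d F <= rsum d G.
Proof.
  revert F G; induction d as [|d IH]; intros F G HFG; [apply Rle_refl|].
  rewrite !rsum_S; apply Rplus_le_compat; [apply HFG; lia|].
  apply IH; intros; apply HFG; lia.
Qed.

Lemma rsum_nonneg (d : nat) (F : nat -> R) :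
  (forall i, (i < d)%nat -> 0 <= F i) -> 0 <= rsum d F.
Proof. intros HF; rewrite <- (rsum_zero d); now apply rsum_le. Qed.

Lemma rsum_Rabs_le (d : nat) (F : nat -> R) :
  Rabs (rsum d F) <= rsum d (fun i => Rabs (F i)).
Proof.
  revert F; induction d as [|d IH]; intros F; [cbn; rewrite Rabs_R0; lra|].
  rewrite !rsum_S; eapply Rle_trans; [apply Rabs_triang|].
  apply Rplus_le_compat_l, IH.
Qed.

Lemma rsum_mult_Rabs_le (d : nat) (F G : nat -> R) (e : R) :
  (forall i, (i < d)%nat -> Rabs (F i) <= e) ->
  Rabs (rsum d (fun i => F i * G i)) <= e * rsum d (fun i => Rabs (G i)).
Proof.
  intros HF; eapply Rle_trans; [apply rsum_Rabs_le|].
  rewrite <- rsum_scal; apply rsum_le; intros i Hi; rewrite Rabs_mult.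
  apply Rmult_le_compat_r; [apply Rabs_pos | auto].
Qed.

Lemma rsum_neq0_exists (d : nat) (F : nat -> R) :
  rsum d F <> 0 -> exists i, (i < d)%nat /\ F i <> 0.
Proof.
  intros HF; apply NNPP; intros Hno; apply HF.
  rewrite <- (rsum_zero d); apply rsum_ext; intros i Hi.
  apply NNPP; intros Hne; apply Hno; eauto.
Qed.

Lemma rsum_permutation (d : nat) (s : list nat) (F : nat -> R) :
  Permutation s (seq 0 d) -> rsum d F = rsum d (fun m => F (nth m s 0%nat)).
Proof.
  intros Hs; unfold rsum.
  assert (Hfold : forall l l' : list R, Permutation l l' ->
            fold_right Rplus 0 l = fold_right Rplus 0 l').
  { induction 1; cbn; lra. }
  rewrite <- (Hfold _ _ (Permutation_map F Hs)).
  rewrite <- (length_seq d 0) at 1; rewrite <- (Permutation_length Hs).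
  clear Hs Hfold; induction s as [|a s IH]; [reflexivity|].
  cbn; now rewrite IH, <- seq_shift, map_map.
Qed.

Definition b2R (b : bool) : R := if b then 1 else 0.

Lemma b2R_bounds (b : bool) : 0 <= b2R b <= 1.
Proof. destruct b; cbn; lra. Qed.

Lemma rsum_delta (d m : nat) (F : nat -> R) :
  (m < d)%nat -> rsum d (fun i => b2R (Nat.eqb i m) * F i) = F m.
Proof.
  revert m F; induction d as [|d IH]; intros m F Hm; [lia|].
  rewrite rsum_S; destruct m as [|m]; cbn [Nat.eqb b2R].
  - rewrite rsum_scal; ring.
  - rewrite (IH m (fun i => F (S i))) by lia; ring.
Qed.

Lemma rsum_term_le (d m : nat) (F : nat -> R) :
  (forall i, (i < d)%nat -> 0 <= F i) -> (m < d)%nat -> F m <= rsum d F.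
Proof.
  intros HF Hm; rewrite <- (rsum_delta d m F Hm); apply rsum_le.
  intros i Hi; specialize (HF i Hi); destruct (Nat.eqb i m); cbn; lra.
Qed.

Lemma INR_list_sum_firstn (l : list nat) (j : nat) :
  INR (list_sum (firstn j l)) =
  rsum (length l) (fun m => INR (nth m l 0%nat) * b2R (Nat.ltb m j)).
Proof.
  revert j; induction l as [|a l IH]; intros [|j]; [reflexivity..| |].
  - rewrite (rsum_ext _ _ (fun _ => 0)); [now rewrite rsum_zero|].
    intros m _; cbn [Nat.ltb Nat.leb b2R]; ring.
  - change (list_sum (firstn (S j) (a :: l))) with (a + list_sum (firstn j l))%nat.
    rewrite plus_INR, IH; cbn [length]; rewrite rsum_S.
    cbn [nth Nat.ltb Nat.leb b2R]; now rewrite Rmult_1_r.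
Qed.

Definition is_int (x : R) : Prop := exists z : Z, x = IZR z.

Lemma is_int_IZR (z : Z) : is_int (IZR z).
Proof. now exists z. Qed.

Lemma is_int_INR (m : nat) : is_int (INR m).
Proof. exists (Z.of_nat m); apply INR_IZR_INZ. Qed.

Lemma is_int_b2R (b : bool) : is_int (b2R b).
Proof. destruct b; [exists 1%Z | exists 0%Z]; reflexivity. Qed.

Lemma is_int_plus (x y : R) : is_int x -> is_int y -> is_int (x + y).
Proof. intros [a ->] [b ->]; exists (a + b)%Z; now rewrite plus_IZR. Qed.

Lemma is_int_minus (x y : R) : is_int x -> is_int y -> is_int (x - y).
Proof. intros [a ->] [b ->]; exists (a - b)%Z; now rewrite minus_IZR. Qed.

Lemma is_int_mult (x y : R) : is_int x -> is_int y -> is_int (x * y).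
Proof. intros [a ->] [b ->]; exists (a * b)%Z; now rewrite mult_IZR. Qed.

Lemma is_int_rsum (d : nat) (F : nat -> R) :
  (forall i, (i < d)%nat -> is_int (F i)) -> is_int (rsum d F).
Proof.
  revert F; induction d as [|d IH]; intros F HF; [apply (is_int_IZR 0)|].
  rewrite rsum_S; apply is_int_plus; [apply HF; lia|].
  apply IH; intros; apply HF; lia.
Qed.

Definition dot (d : nat) (c x : nat -> R) : R := rsum d (fun i => c i * x i).

Lemma dot_S (d : nat) (c x : nat -> R) :
  dot (S d) c x =
  c 0%nat * x 0%nat + dot d (fun i => c (S i)) (fun i => x (S i)).
Proof. apply rsum_S. Qed.

Lemma dot_comm (d : nat) (c x : nat -> R) : dot d c x = dot d x c.
Proof. apply rsum_ext; intros; ring. Qed.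

Lemma dot_ext (d : nat) (c x y : nat -> R) :
  (forall i, (i < d)%nat -> x i = y i) -> dot d c x = dot d c y.
Proof. intros Hxy; apply rsum_ext; intros; now rewrite Hxy. Qed.

Lemma dot_plus (d : nat) (c x y : nat -> R) :
  dot d c (fun i => x i + y i) = dot d c x + dot d c y.
Proof.
  unfold dot; rewrite <- rsum_plus; apply rsum_ext; intros; ring.
Qed.

Lemma dot_scal (d : nat) (c x : nat -> R) (a : R) :
  dot d c (fun i => a * x i) = a * dot d c x.
Proof.
  unfold dot; rewrite <- rsum_scal; apply rsum_ext; intros; ring.
Qed.

Lemma dot_minus (d : nat) (c x y : nat -> R) :
  dot d c (fun i => x i - y i) = dot d c x - dot d c y.
Proof.
  unfold dot; rewrite <- rsum_minus; apply rsum_ext; intros; ring.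
Qed.

Lemma dot_const (d : nat) (c : nat -> R) (a : R) :
  dot d c (fun _ => a) = a * dot d c (fun _ => 1).
Proof. rewrite <- dot_scal; apply dot_ext; intros; ring. Qed.

Lemma dot_rsum (d e : nat) (c y : nat -> R) (F : nat -> nat -> R) :
  dot d c (fun i => rsum e (fun j => y j * F j i)) =
  rsum e (fun j => y j * dot d c (F j)).
Proof.
  unfold dot.
  rewrite (rsum_ext d _ (fun i => rsum e (fun j => c i * (y j * F j i))))
    by (intros; now rewrite rsum_scal).
  rewrite rsum_swap; apply rsum_ext; intros j _.
  rewrite <- rsum_scal; apply rsum_ext; intros; ring.
Qed.

Lemma is_int_dot (d : nat) (c x : nat -> R) :
  (forall i, (i < d)%nat -> is_int (c i)) -> (forall i, (i < d)%nat -> is_int (x i)) ->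
  is_int (dot d c x).
Proof. intros; apply is_int_rsum; intros; apply is_int_mult; auto. Qed.

(** * Unimodular completion of a primitive vector *)

(* The forms [C j] are the rows, and the vectors [E j] the columns, of two mutually
   inverse matrices of GL_d(Z). *)
Record dual_bases (d : nat) (C E : nat -> nat -> R) : Prop := {
  dual_bases_is_int_form : forall j i, is_int (C j i);
  dual_bases_is_int_vector : forall j i, is_int (E j i);
  dual_bases_dot : forall i j, (i < d)%nat -> (j < d)%nat ->
    dot d (C i) (E j) = b2R (Nat.eqb i j);
  dual_bases_expansion : forall x i, (i < d)%nat ->
    x i = rsum d (fun j => dot d (C j) x * E j i)
}.

Arguments dual_bases_is_int_form {d C E}.
Arguments dual_bases_is_int_vector {d C E}.
Arguments dual_bases_dot {d C E}.
Arguments dual_bases_expansion {d C E}.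

Definition extend_basis (B : nat -> nat -> R) (j i : nat) : R :=
  match j, i with
  | O, O => 1
  | S j, S i => B j i
  | _, _ => 0
  end.

Lemma dot_extend_basis_S (d : nat) (B : nat -> nat -> R) (j : nat) (x : nat -> R) :
  dot (S d) (extend_basis B (S j)) x = dot d (B j) (fun i => x (S i)).
Proof. rewrite dot_S; cbn [extend_basis]; rewrite Rmult_0_l; apply Rplus_0_l. Qed.

Lemma dot_extend_basis_0 (d : nat) (B : nat -> nat -> R) (x : nat -> R) :
  dot (S d) (extend_basis B 0) x = x 0%nat.
Proof.
  rewrite dot_S; cbn [extend_basis].
  rewrite dot_comm, (dot_const _ _ 0); ring.
Qed.

Lemma dual_bases_extend (d : nat) (C E : nat -> nat -> R) :
  dual_bases d C E -> dual_bases (S d) (extend_basis C) (extend_basis E).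
Proof.
  intros [HC HE Hdot Hexp]; split.
  1,2: intros [|j] [|i]; cbn; auto; [apply (is_int_IZR 1) | apply (is_int_IZR 0)..].
  - intros [|i] j Hi Hj.
    + rewrite dot_extend_basis_0; now destruct j.
    + rewrite dot_extend_basis_S; destruct j as [|j].
      * cbn [extend_basis Nat.eqb b2R]; rewrite dot_const; ring.
      * exact (Hdot i j ltac:(lia) ltac:(lia)).
  - intros x [|i] Hi; rewrite rsum_S, dot_extend_basis_0; cbn [extend_basis].
    + rewrite (rsum_ext _ _ (fun _ => 0)) by (intros; ring).
      rewrite rsum_zero; ring.
    + rewrite (Hexp (fun i => x (S i))) by lia; rewrite Rmult_0_r, Rplus_0_l.
      apply rsum_ext; intros; now rewrite dot_extend_basis_S.
Qed.

Definition mix_basis (a b a' b' : Z) (B : nat -> nat -> R) (j i : nat) : R :=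
  match j with
  | O => IZR a * B 0%nat i + IZR b * B 1%nat i
  | 1%nat => IZR a' * B 0%nat i + IZR b' * B 1%nat i
  | _ => B j i
  end.

Lemma is_int_mix_basis (a b a' b' : Z) (B : nat -> nat -> R) :
  (forall j i, is_int (B j i)) -> forall j i, is_int (mix_basis a b a' b' B j i).
Proof.
  intros HB [|[|j]] i; cbn; auto;
    apply is_int_plus; apply is_int_mult; auto using is_int_IZR.
Qed.

Lemma dot_mix_basis_r (d : nat) (a b a' b' : Z) (B : nat -> nat -> R) (c : nat -> R)
    (j : nat) :
  dot d c (mix_basis a b a' b' B j) =
  match j with
  | O => IZR a * dot d c (B 0%nat) + IZR b * dot d c (B 1%nat)
  | 1%nat => IZR a' * dot d c (B 0%nat) + IZR b' * dot d c (B 1%nat)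
  | _ => dot d c (B j)
  end.
Proof.
  unfold mix_basis; destruct j as [|[|j]];
    [rewrite dot_plus, !dot_scal | rewrite dot_plus, !dot_scal |]; reflexivity.
Qed.

Lemma dual_bases_mix (d : nat) (C E : nat -> nat -> R) (a b u v : Z) :
  dual_bases (S (S d)) C E -> (u * a + v * b = 1)%Z ->
  dual_bases (S (S d)) (mix_basis a b (- v) u C) (mix_basis u v (- b) a E).
Proof.
  intros [HC HE Hdot Hexp] Hdet.
  assert (HdetR : IZR u * IZR a + IZR v * IZR b = 1).
  { now rewrite <- !mult_IZR, <- plus_IZR, Hdet. }
  assert (Hdotl : forall j x, dot (S (S d)) (mix_basis a b (- v) u C j) x =
            match j with
            | O => IZR a * dot (S (S d)) (C 0%nat) x + IZR b * dot (S (S d)) (C 1%nat) x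
            | 1%nat => - IZR v * dot (S (S d)) (C 0%nat) x
                       + IZR u * dot (S (S d)) (C 1%nat) x
            | _ => dot (S (S d)) (C j) x
            end).
  { intros j x; rewrite dot_comm, dot_mix_basis_r, opp_IZR.
    now rewrite !(dot_comm _ x). }
  split.
  - now apply is_int_mix_basis.
  - now apply is_int_mix_basis.
  - intros i j Hi Hj; rewrite dot_mix_basis_r, !Hdotl.
    destruct i as [|[|i]], j as [|[|j]];
      rewrite !Hdot by lia; cbn [Nat.eqb b2R]; rewrite ?opp_IZR; lra.
  - intros x i Hi; rewrite !rsum_S.
    rewrite (rsum_ext d _ (fun j => dot (S (S d)) (C (S (S j))) x * E (S (S j)) i))
      by (intros; now rewrite Hdotl).
    rewrite (Hexp x i Hi), !rsum_S, !Hdotl; cbn [mix_basis]; rewrite opp_IZR.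
    set (x0 := dot _ (C 0%nat) x); set (x1 := dot _ (C 1%nat) x).
    set (rest := rsum d _).
    transitivity ((IZR u * IZR a + IZR v * IZR b) *
      (x0 * E 0%nat i + x1 * E 1%nat i) + rest); [rewrite HdetR|]; ring.
Qed.

Lemma Nat_gcd_cofactors (a b : nat) : exists p q u v : Z,
  (Z.of_nat a = Z.of_nat (Nat.gcd a b) * p /\
   Z.of_nat b = Z.of_nat (Nat.gcd a b) * q /\ u * p + v * q = 1)%Z.
Proof.
  destruct (Nat.eq_dec (Nat.gcd a b) 0) as [Hgcd|Hgcd].
  { apply Nat.gcd_eq_0 in Hgcd as [-> ->]; exists 1%Z, 0%Z, 1%Z, 0%Z; cbn; lia. }
  destruct (Nat.gcd_divide_l a b) as [p Hp], (Nat.gcd_divide_r a b) as [q Hq].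
  destruct (Nat.gcd_bezout a b) as [(u & v & Huv)|(v & u & Huv)].
  - exists (Z.of_nat p), (Z.of_nat q), (Z.of_nat u), (- Z.of_nat v)%Z; nia.
  - exists (Z.of_nat p), (Z.of_nat q), (- Z.of_nat u)%Z, (Z.of_nat v); nia.
Qed.

(* One Bezout step per entry: a combination of determinant 1 of the first two forms
   makes [a :: L] a multiple of the first one. *)
Lemma dual_bases_exists (L : list nat) :
  (0 < length L)%nat ->
  exists C E, dual_bases (length L) C E /\
    forall i, INR (lval L i) = INR (fold_right Nat.gcd 0%nat L) * C 0%nat i.
Proof.
  induction L as [|a [|b L] IH]; intros Hlen; [cbn in Hlen; lia|..].
  - exists (extend_basis (fun _ _ => 0)), (extend_basis (fun _ _ => 0)); split.
    + apply (dual_bases_extend 0); split; intros; [apply (is_int_IZR 0).. | lia | lia].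
    + cbn [fold_right]; rewrite Nat.gcd_0_r; intros [|[|i]]; cbn; ring.
  - destruct IH as (C & E & HCE & HC0); [cbn; lia|].
    set (g := fold_right Nat.gcd 0%nat (b :: L)) in *.
    destruct (Nat_gcd_cofactors a g) as (p & q & u & v & Hp & Hq & Huv).
    exists (mix_basis p q (- v) u (extend_basis C)),
      (mix_basis u v (- q) p (extend_basis E)); split.
    + now apply dual_bases_mix, Huv; apply dual_bases_extend.
    + apply (f_equal IZR) in Hp, Hq; rewrite mult_IZR, <- !INR_IZR_INZ in Hp, Hq.
      change (fold_right Nat.gcd 0%nat (a :: b :: L)) with (Nat.gcd a g).
      intros [|i]; cbn [mix_basis extend_basis].
      * change (lval (a :: b :: L) 0) with a; rewrite Hp; ring.
      * change (lval (a :: b :: L) (S i)) with (lval (b :: L) i).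
        rewrite HC0, Hq; ring.
Qed.

(** * Homeomorphisms onto the torus *)

Lemma homeomorphic_of_uniform_inverse (m1 m2 : nat) (A B : (nat -> R) -> Prop)
    (f : (nat -> R) -> nat -> R) :
  (forall p, A p -> forall i, (m1 <= i)%nat -> p i = 0) ->
  (forall p, A p -> B (f p)) ->
  continuous_on m1 m2 A f ->
  (forall q, B q -> exists p, A p /\ forall t, f p t = q t) ->
  (forall eps, 0 < eps -> exists delta, 0 < delta /\ forall p p', A p -> A p' ->
     (forall t, (t < m2)%nat -> Rabs (f p t - f p' t) < delta) ->
     forall i, (i < m1)%nat -> Rabs (p i - p' i) < eps) ->
  homeomorphic m1 m2 A B.
Proof.
  intros HA0 Hmaps Hcont Hsurj Hinv.
  destruct (choice (fun q p => B q -> A p /\ forall t, f p t = q t)) as [g Hg].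
  { intros q; destruct (classic (B q)) as [Hq|Hq].
    - destruct (Hsurj q Hq) as [p Hp]; exists p; auto.
    - exists q; tauto. }
  exists f, g; repeat split; auto.
  - intros q Hq; apply Hg, Hq.
  - intros p Hp i; destruct (Hg (f p) (Hmaps p Hp)) as [Hgp Hfg].
    destruct (Nat.lt_ge_cases i m1) as [Hi|Hi]; [|now rewrite !HA0].
    apply cond_eq; intros eps Heps.
    destruct (Hinv eps Heps) as (delta & Hdelta & Hclose).
    apply Hclose; auto; intros t _; now rewrite Hfg, Rminus_diag, Rabs_R0.
  - intros q Hq; apply Hg, Hq.
  - intros q Hq eps Heps; destruct (Hinv eps Heps) as (delta & Hdelta & Hclose).
    exists delta; split; [exact Hdelta|]; intros q' Hq' Hqq'.
    destruct (Hg q Hq) as [Hgq Hfg], (Hg q' Hq') as [Hgq' Hfg'].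
    apply Hclose; auto; intros t Ht; rewrite Hfg, Hfg'; auto.
Qed.

Lemma cos_sin_shift_int (a b : R) :
  is_int (a - b) ->
  cos (2 * PI * a) = cos (2 * PI * b) /\ sin (2 * PI * a) = sin (2 * PI * b).
Proof.
  intros [z Hz].
  assert (Hs : sin (IZR z * PI) = 0) by (apply sin_eq_0_1; now exists z).
  replace (2 * PI * a) with (2 * PI * b + 2 * (IZR z * PI)) by (rewrite <- Hz; ring).
  rewrite cos_plus, sin_plus, cos_2a_sin, sin_2a, Hs; split; ring.
Qed.

Lemma circle_angle (c s : R) :
  c ^ 2 + s ^ 2 = 1 -> exists y, cos (2 * PI * y) = c /\ sin (2 * PI * y) = s.
Proof.
  intros Hcircle; assert (Hc : -1 <= c <= 1) by nra.
  assert (HPI := PI_neq0).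
  assert (Hsq : sqrt (1 - c²) = Rabs s).
  { rewrite <- sqrt_Rsqr_abs; f_equal; unfold Rsqr; lra. }
  destruct (Rle_lt_dec 0 s) as [Hs|Hs].
  - exists (acos c / (2 * PI)).
    replace (2 * PI * (acos c / (2 * PI))) with (acos c) by (field; auto).
    rewrite cos_acos, sin_acos, Hsq, Rabs_right by lra; auto.
  - exists (- acos c / (2 * PI)).
    replace (2 * PI * (- acos c / (2 * PI))) with (- acos c) by (field; auto).
    rewrite cos_neg, sin_neg, cos_acos, sin_acos, Hsq, Rabs_left by lra; lra.
Qed.

Lemma derivative_bound_lipschitz (f f' : R -> R) (M x y : R) :
  (forall c, derivable_pt_lim f c (f' c)) -> (forall c, Rabs (f' c) <= M) ->
  Rabs (f x - f y) <= M * Rabs (x - y).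
Proof.
  intros Hf HM; destruct (MVT_abs f f' y x) as (c & -> & _); [auto|].
  apply Rmult_le_compat_r; [apply Rabs_pos | apply HM].
Qed.

Lemma cos_lipschitz (x y : R) : Rabs (cos x - cos y) <= Rabs (x - y).
Proof.
  rewrite <- (Rmult_1_l (Rabs (x - y))).
  apply (derivative_bound_lipschitz cos (fun c => - sin c)).
  - apply derivable_pt_lim_cos.
  - intros c; rewrite Rabs_Ropp; apply Rabs_le, SIN_bound.
Qed.

Lemma sin_lipschitz (x y : R) : Rabs (sin x - sin y) <= Rabs (x - y).
Proof.
  rewrite <- (Rmult_1_l (Rabs (x - y))).
  apply (derivative_bound_lipschitz sin cos).
  - apply derivable_pt_lim_sin.
  - intros c; apply Rabs_le, COS_bound.
Qed.

Lemma Rabs_lt_of_sin_lt (x a : R) :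
  Rabs x <= PI / 2 -> 0 < a <= PI / 2 -> Rabs (sin x) < sin a -> Rabs x < a.
Proof.
  intros Hx Ha Hsin; apply Rabs_def2 in Hsin.
  pose proof (Rle_abs x); pose proof (Rle_abs (- x)) as Hx'; rewrite Rabs_Ropp in Hx'.
  apply Rabs_def1.
  - apply sin_increasing_0; lra.
  - apply sin_increasing_0; try lra; rewrite sin_neg; lra.
Qed.

Lemma chord_sqr (a b : R) :
  (cos (2 * PI * a) - cos (2 * PI * b)) ^ 2
  + (sin (2 * PI * a) - sin (2 * PI * b)) ^ 2 = 4 * sin (PI * (a - b)) ^ 2.
Proof.
  pose proof (cos_2a_sin (PI * (a - b))) as Hcos.
  replace (2 * (PI * (a - b))) with (2 * PI * a - 2 * PI * b) in Hcos by ring.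
  rewrite cos_minus in Hcos.
  pose proof (sin2_cos2 (2 * PI * a)); pose proof (sin2_cos2 (2 * PI * b)).
  unfold Rsqr in *; nra.
Qed.

Lemma circle_angle_close (eps : R) :
  0 < eps -> exists delta, 0 < delta /\ forall a b,
    Rabs (cos (2 * PI * a) - cos (2 * PI * b)) < delta ->
    Rabs (sin (2 * PI * a) - sin (2 * PI * b)) < delta ->
    exists z, Rabs (a - b - IZR z) < eps.
Proof.
  intros Heps; assert (HPI := PI_RGT_0).
  set (e := Rmin eps (1 / 2)).
  assert (He : 0 < e <= 1 / 2) by (split; [apply Rmin_glb_lt; lra | apply Rmin_r]).
  assert (Hsin : 0 < sin (PI * e)) by (apply sin_gt_0; nra).
  exists (sin (PI * e)); split; [exact Hsin|]; intros a b Hcab Hsab.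
  set (z := Int_part (a - b + 1 / 2)); exists z.
  assert (Ht : Rabs (a - b - IZR z) <= 1 / 2).
  { destruct (base_Int_part (a - b + 1 / 2)); apply Rabs_le; unfold z; lra. }
  assert (Hchord : sin (PI * (a - b - IZR z)) ^ 2 < sin (PI * e) ^ 2).
  { destruct (cos_sin_shift_int (b + IZR z) b) as [Hc Hs]; [exists z; ring|].
    replace (a - b - IZR z) with (a - (b + IZR z)) by ring.
    pose proof (chord_sqr a (b + IZR z)) as Hab; rewrite Hc, Hs in Hab.
    apply Rabs_def2 in Hcab, Hsab; nra. }
  assert (Hclose : Rabs (PI * (a - b - IZR z)) < PI * e).
  { apply Rabs_lt_of_sin_lt.
    - rewrite Rabs_mult, (Rabs_right PI) by lra; nra.
    - nra.
    - rewrite <- !Rsqr_pow2 in Hchord; apply Rsqr_lt_abs_0 in Hchord.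
      now rewrite (Rabs_right (sin (PI * e))) in Hchord by lra. }
  rewrite Rabs_mult, (Rabs_right PI) in Hclose by lra.
  apply Rmult_lt_reg_l in Hclose; [|exact HPI].
  eapply Rlt_le_trans; [exact Hclose | apply Rmin_l].
Qed.

Definition torus_point (d : nat) (y : nat -> R) (t : nat) : R :=
  if Nat.ltb t (2 * d)
  then if Nat.even t then cos (2 * PI * y (Nat.div2 t))
       else sin (2 * PI * y (Nat.div2 t))
  else 0.

Lemma torus_point_even (d : nat) (y : nat -> R) (j : nat) :
  (j < d)%nat -> torus_point d y (2 * j) = cos (2 * PI * y j).
Proof.
  intros Hj; unfold torus_point.
  rewrite (proj2 (Nat.ltb_lt _ _)), Nat.even_even, Nat.div2_double by lia; auto.
Qed.

Lemma torus_point_odd (d : nat) (y : nat -> R) (j : nat) :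
  (j < d)%nat -> torus_point d y (2 * j + 1) = sin (2 * PI * y j).
Proof.
  intros Hj; unfold torus_point.
  rewrite (proj2 (Nat.ltb_lt _ _)), Nat.even_odd by lia.
  now rewrite Nat.add_1_r, Nat.div2_succ_double.
Qed.

Lemma torus_point_high (d : nat) (y : nat -> R) (t : nat) :
  (2 * d <= t)%nat -> torus_point d y t = 0.
Proof.
  intros Ht; unfold torus_point; destruct (Nat.ltb_spec t (2 * d)); [lia|auto].
Qed.

Lemma torus_index (d : nat) (Q : nat -> Prop) :
  (forall j, (j < d)%nat -> Q (2 * j)%nat) ->
  (forall j, (j < d)%nat -> Q (2 * j + 1)%nat) ->
  forall t, (t < 2 * d)%nat -> Q t.
Proof.
  intros Heven Hodd t Ht; destruct (Nat.Even_or_Odd t) as [[j ->]|[j ->]];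
    [apply Heven | apply Hodd]; lia.
Qed.

Lemma torus_torus_point (d : nat) (y : nat -> R) : torus d (torus_point d y).
Proof.
  split.
  - intros i Hi; rewrite torus_point_even, torus_point_odd by auto.
    pose proof (sin2_cos2 (2 * PI * y i)) as Hpyth.
    unfold Rsqr in Hpyth; lra.
  - apply torus_point_high.
Qed.

Lemma torus_point_shift_int (d : nat) (y y' : nat -> R) :
  (forall j, (j < d)%nat -> is_int (y j - y' j)) ->
  forall t, torus_point d y t = torus_point d y' t.
Proof.
  intros Hyy' t; destruct (Nat.lt_ge_cases t (2 * d)) as [Ht|Ht].
  - revert t Ht; apply torus_index; intros j Hj.
    + rewrite !torus_point_even by auto; now apply cos_sin_shift_int, Hyy'.
    + rewrite !torus_point_odd by auto; now apply cos_sin_shift_int, Hyy'.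
  - now rewrite !torus_point_high.
Qed.

Lemma torus_point_surj (d : nat) (q : nat -> R) :
  torus d q -> exists y, forall t, torus_point d y t = q t.
Proof.
  intros [Hcircle Hhigh].
  destruct (choice (fun j y => (j < d)%nat ->
    cos (2 * PI * y) = q (2 * j)%nat /\ sin (2 * PI * y) = q (2 * j + 1)%nat))
    as [y Hy].
  { intros j; destruct (Nat.lt_ge_cases j d) as [Hj|Hj].
    - destruct (circle_angle _ _ (Hcircle j Hj)) as [y Hy]; exists y; auto.
    - exists 0; lia. }
  exists y; intros t; destruct (Nat.lt_ge_cases t (2 * d)) as [Ht|Ht].
  - revert t Ht; apply torus_index; intros j Hj.
    + rewrite torus_point_even by auto; now apply Hy.
    + rewrite torus_point_odd by auto; now apply Hy.
  - rewrite torus_point_high by auto; symmetry; auto.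
Qed.

Lemma torus_point_lipschitz (d : nat) (y y' : nat -> R) (r : R) :
  (forall j, (j < d)%nat -> Rabs (y j - y' j) <= r) ->
  forall t, (t < 2 * d)%nat ->
  Rabs (torus_point d y t - torus_point d y' t) <= 2 * PI * r.
Proof.
  intros Hyy'.
  assert (Hangle : forall j, (j < d)%nat ->
            Rabs (2 * PI * y j - 2 * PI * y' j) <= 2 * PI * r).
  { intros j Hj; pose proof PI_RGT_0.
    rewrite <- Rmult_minus_distr_l, Rabs_mult, (Rabs_right (2 * PI)) by lra.
    apply Rmult_le_compat_l; [lra | auto]. }
  apply torus_index; intros j Hj.
  - rewrite !torus_point_even by auto.
    eapply Rle_trans; [apply cos_lipschitz | auto].
  - rewrite !torus_point_odd by auto.
    eapply Rle_trans; [apply sin_lipschitz | auto].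
Qed.

Lemma torus_point_close (d : nat) (eps : R) :
  0 < eps -> exists delta, 0 < delta /\ forall y y',
    (forall t, (t < 2 * d)%nat ->
       Rabs (torus_point d y t - torus_point d y' t) < delta) ->
    forall j, (j < d)%nat -> exists z, Rabs (y j - y' j - IZR z) < eps.
Proof.
  intros Heps; destruct (circle_angle_close eps Heps) as (delta & Hdelta & Hclose).
  exists delta; split; [exact Hdelta|]; intros y y' Hyy' j Hj; apply Hclose.
  - rewrite <- !(torus_point_even d) by auto; apply Hyy'; lia.
  - rewrite <- !(torus_point_odd d) by auto; apply Hyy'; lia.
Qed.

(** * Tail sums and sorted lists *)

Definition tail_sum (k : nat) (t : nat -> R) (m : nat) : R :=
  rsum k (fun j => t j * b2R (Nat.ltb m j)).

Lemma tail_sum_last (k : nat) (t : nat -> R) : tail_sum k t (k - 1) = 0.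
Proof.
  rewrite <- (rsum_zero k); apply rsum_ext; intros j Hj.
  destruct (Nat.ltb_spec (k - 1) j); [lia | apply Rmult_0_r].
Qed.

Lemma tail_sum_first (k : nat) (t : nat -> R) :
  (0 < k)%nat -> rsum k t = t 0%nat + tail_sum k t 0.
Proof.
  destruct k as [|k]; [lia|]; intros _; unfold tail_sum; rewrite !rsum_S.
  cbn [Nat.ltb Nat.leb b2R]; rewrite Rmult_0_r, Rplus_0_l; f_equal.
  apply rsum_ext; intros; ring.
Qed.

Lemma tail_sum_step (k : nat) (t : nat -> R) (m : nat) :
  (S m < k)%nat -> tail_sum k t m = t (S m) + tail_sum k t (S m).
Proof.
  intros Hm; unfold tail_sum; rewrite <- (rsum_delta k (S m) t Hm), <- rsum_plus.
  apply rsum_ext; intros j _.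
  destruct (Nat.ltb_spec m j), (Nat.ltb_spec (S m) j), (Nat.eqb_spec j (S m));
    cbn; lra || lia.
Qed.

Lemma tail_sum_decr (k : nat) (t : nat -> R) (m m' : nat) :
  (forall j, (j < k)%nat -> 0 <= t j) -> (m <= m')%nat ->
  0 <= tail_sum k t m - tail_sum k t m' <= rsum k t.
Proof.
  intros Ht Hm; unfold tail_sum; rewrite <- rsum_minus; split.
  - apply rsum_nonneg; intros j Hj; specialize (Ht j Hj).
    destruct (Nat.ltb_spec m j), (Nat.ltb_spec m' j); cbn; lra || lia.
  - apply rsum_le; intros j Hj; specialize (Ht j Hj).
    destruct (Nat.ltb_spec m j), (Nat.ltb_spec m' j); cbn; lra || lia.
Qed.

(* The weights whose tail sums are the values of [rho], normalised at the last one. *)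
Definition gaps (k : nat) (rho : nat -> R) (j : nat) : R :=
  match j with
  | O => 1 - (rho 0%nat - rho (k - 1)%nat)
  | S j => rho j - rho (S j)
  end.

Lemma tail_sum_gaps (k : nat) (rho : nat -> R) (m : nat) :
  (m < k)%nat -> tail_sum k (gaps k rho) m = rho m - rho (k - 1)%nat.
Proof.
  intros Hm; replace m with (k - 1 - (k - 1 - m))%nat by lia.
  generalize (k - 1 - m)%nat as e; induction e as [|e IH].
  - rewrite Nat.sub_0_r, tail_sum_last; ring.
  - destruct (Nat.lt_ge_cases e (k - 1)) as [He|He].
    + rewrite tail_sum_step by lia; cbn [gaps].
      replace (S (k - 1 - S e)) with (k - 1 - e)%nat by lia; rewrite IH; ring.
    + now replace (k - 1 - S e)%nat with (k - 1 - e)%nat by lia.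
Qed.

Lemma rsum_gaps (k : nat) (rho : nat -> R) : (0 < k)%nat -> rsum k (gaps k rho) = 1.
Proof.
  intros Hk; rewrite tail_sum_first, tail_sum_gaps by auto; cbn [gaps]; ring.
Qed.

Lemma gaps_nonneg (k : nat) (rho : nat -> R) (j : nat) :
  (forall m, (S m < k)%nat -> rho (S m) <= rho m) ->
  rho 0%nat - rho (k - 1)%nat <= 1 -> (j < k)%nat -> 0 <= gaps k rho j.
Proof.
  intros Hrho Hrange Hj; destruct j as [|j]; cbn [gaps]; [lra|].
  specialize (Hrho j Hj); lra.
Qed.

Lemma single_drop (k : nat) (d : nat -> Z) :
  (0 < k)%nat ->
  (forall m m', (m <= m' < k)%nat -> (0 <= d m - d m' <= 1)%Z) ->
  exists m, (m < k)%nat /\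
    forall j, (j < k)%nat -> d j = (d (k - 1)%nat + Z.b2z (Nat.ltb j m))%Z.
Proof.
  revert d; induction k as [|k IH]; intros d Hk Hd; [lia|].
  replace (S k - 1)%nat with k by lia.
  destruct (Z.eq_dec (d 0%nat) (d k)) as [Heq|Hne].
  - exists 0%nat; split; [lia|]; intros j Hj; cbn.
    pose proof (Hd 0%nat j ltac:(lia)); pose proof (Hd j k ltac:(lia)); lia.
  - assert (0 < k)%nat by (destruct k; [tauto | lia]).
    destruct (IH (fun j => d (S j))) as (m & Hm & Hdrop); [lia|intros; apply Hd; lia|].
    replace (S (k - 1)) with k in Hdrop by lia.
    exists (S m); split; [lia|]; intros [|j] Hj; [|apply Hdrop; lia].
    pose proof (Hd 0%nat k ltac:(lia)); cbn; lia.
Qed.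

Lemma tail_sum_osc (k : nat) (t : nat -> R) (d : nat -> Z) (r : R) :
  (0 < k)%nat -> (forall j, (j < k)%nat -> 0 <= t j) -> rsum k t = 1 -> r < 1 ->
  (forall m m', (m < k)%nat -> (m' < k)%nat ->
     (tail_sum k t m - IZR (d m)) - (tail_sum k t m' - IZR (d m')) <= r) ->
  exists m, (m < k)%nat /\ 1 - r <= t m /\
    forall j, (j < k)%nat -> IZR (d j) = IZR (d (k - 1)%nat) + b2R (Nat.ltb j m).
Proof.
  intros Hk Ht Hsum Hr Hosc.
  destruct (single_drop k d Hk) as (m & Hm & Hdrop).
  { intros m m' Hm.
    pose proof (tail_sum_decr k t m m' Ht ltac:(lia)).
    pose proof (Hosc m m' ltac:(lia) ltac:(lia)).
    pose proof (Hosc m' m ltac:(lia) ltac:(lia)).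
    assert (-1 < IZR (d m - d m') < 2) as [Hlow Hhigh] by (rewrite minus_IZR; lra).
    apply lt_IZR in Hlow, Hhigh; lia. }
  assert (HdropR : forall j, (j < k)%nat ->
            IZR (d j) = IZR (d (k - 1)%nat) + b2R (Nat.ltb j m)).
  { intros j Hj; rewrite Hdrop, plus_IZR by auto; now destruct (Nat.ltb j m). }
  exists m; repeat split; [exact Hm | | exact HdropR].
  destruct m as [|m].
  - specialize (Hosc 0%nat (k - 1)%nat Hk ltac:(lia)).
    rewrite (HdropR 0%nat Hk), tail_sum_last in Hosc.
    rewrite tail_sum_first in Hsum by auto; cbn in Hosc; lra.
  - specialize (Hosc (S m) m Hm ltac:(lia)).
    rewrite (HdropR (S m)), (HdropR m), (tail_sum_step k t m) in Hosc by lia.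
    rewrite (proj2 (Nat.ltb_lt m (S m))), Nat.ltb_irrefl in Hosc by lia.
    cbn in Hosc; lra.
Qed.

Lemma StronglySorted_insert (A : Type) (leA : A -> A -> Prop) (a : A) (l : list A) :
  (forall b c, leA b c \/ leA c b) ->
  (forall b c d, leA b c -> leA c d -> leA b d) ->
  StronglySorted leA l ->
  exists l', Permutation l' (a :: l) /\ StronglySorted leA l'.
Proof.
  intros Htotal Htrans; induction 1 as [|b l Hl (l' & Hperm & Hl') Hb].
  - exists [a]; split; repeat constructor.
  - destruct (Htotal a b) as [Hab|Hba].
    + exists (a :: b :: l); split; [reflexivity|].
      constructor; [now constructor|]; constructor; [exact Hab|].
      eapply Forall_impl; [|exact Hb]; eauto.
    + exists (b :: l'); split; [rewrite Hperm; apply perm_swap|].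
      constructor; [exact Hl'|]; rewrite Hperm; now constructor.
Qed.

Lemma exists_StronglySorted (A : Type) (leA : A -> A -> Prop) (l : list A) :
  (forall b c, leA b c \/ leA c b) ->
  (forall b c d, leA b c -> leA c d -> leA b d) ->
  exists s, Permutation s l /\ StronglySorted leA s.
Proof.
  intros Htotal Htrans; induction l as [|a l (s & Hs & Hsort)].
  - exists []; split; constructor.
  - destruct (StronglySorted_insert A leA a s Htotal Htrans Hsort) as (s' & Hs' & Hsort').
    exists s'; split; [now rewrite Hs', Hs | exact Hsort'].
Qed.

Lemma StronglySorted_nth_S (A : Type) (leA : A -> A -> Prop) (a : A) (s : list A)
    (m : nat) :
  StronglySorted leA s -> (S m < length s)%nat -> leA (nth m s a) (nth (S m) s a).
Proof.
  intros Hsort; revert m; induction Hsort as [|b s Hsort IH Hb]; cbn [length];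
    intros m Hm; [lia|].
  destruct m as [|m]; [|apply IH; lia].
  rewrite Forall_forall in Hb; cbn [nth]; apply Hb, nth_In; lia.
Qed.

(** * Vertices of a simplex *)

Local Notation weight L := (dot (length L) (fun i => INR (lval L i))).

Lemma weight_one (L : list nat) : weight L (fun _ => 1) = INR (list_sum L).
Proof.
  rewrite <- (firstn_all L) at 2; rewrite INR_list_sum_firstn.
  apply rsum_ext; intros i Hi; now rewrite (proj2 (Nat.ltb_lt _ _) Hi).
Qed.

Lemma weight_b2R (L : list nat) (I : nat -> bool) :
  weight L (fun i => b2R (I i)) = INR (subsum L I).
Proof.
  assert (Hfold : forall l, INR (list_sum l) = fold_right Rplus 0 (map INR l)).
  { induction l as [|a l IH]; [reflexivity|].
    cbn [map fold_right]; rewrite <- IH; apply plus_INR. }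
  unfold subsum; rewrite Hfold, map_map; apply rsum_ext.
  intros i _; destruct (I i); cbn [b2R]; [ring | rewrite INR_0; ring].
Qed.

(* An arbitrary subset when [r] is not a subset sum. *)
Definition subset_of (L : list nat) (r : nat) : nat -> bool :=
  epsilon (inhabits (fun _ => false)) (fun I => subsum L I = r).

Lemma subset_of_subsum (L : list nat) (I : nat -> bool) (i : nat) :
  generic L -> (i < length L)%nat -> subset_of L (subsum L I) i = I i.
Proof.
  intros Hgen Hi; apply Hgen; [|exact Hi].
  unfold subset_of; apply epsilon_spec; now exists I.
Qed.

Lemma subset_of_zero (L : list nat) (i : nat) :
  generic L -> (i < length L)%nat -> subset_of L 0 i = false.
Proof.
  intros Hgen Hi; rewrite <- (subset_of_subsum L (fun _ => false) i Hgen Hi).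
  f_equal; apply INR_eq; rewrite <- weight_b2R; symmetry.
  rewrite dot_const; apply Rmult_0_l.
Qed.

Lemma list_sum_firstn_lt (l : list nat) (u w : nat) :
  (forall a, In a l -> (0 < a)%nat) -> (u < w <= length l)%nat ->
  (list_sum (firstn u l) < list_sum (firstn w l))%nat.
Proof.
  revert u w; induction l as [|a l IH]; intros [|u] [|w] Hl Huw; cbn in Huw; try lia.
  - specialize (Hl a (or_introl eq_refl)); change (0 < a + list_sum (firstn w l))%nat.
    lia.
  - change (a + list_sum (firstn u l) < a + list_sum (firstn w l))%nat.
    apply Nat.add_lt_mono_l, IH; [auto using in_cons | lia].
Qed.

Lemma list_sum_pos (L : list nat) :
  (0 < length L)%nat -> (forall i, (i < length L)%nat -> (0 < lval L i)%nat) ->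
  (0 < list_sum L)%nat.
Proof.
  intros Hk Hpos; specialize (Hpos 0%nat Hk); destruct L; cbn in *; lia.
Qed.

Lemma mod_sub_mod (n a b c r : nat) :
  (r < n)%nat -> (r + b = a + c * n)%nat -> ((a mod n + n - b mod n) mod n)%nat = r.
Proof.
  intros Hr Hab; pose proof (Nat.mod_upper_bound b n ltac:(lia)).
  apply Nat2Z.inj; rewrite Nat2Z.inj_mod, Nat2Z.inj_sub, Nat2Z.inj_add by lia.
  rewrite !Nat2Z.inj_mod, Zminus_mod_idemp_r, <- Z.add_sub_assoc, Zplus_mod_idemp_l.
  symmetry; apply (Z.mod_unique_pos _ _ (1 - Z.of_nat c)); nia.
Qed.

Definition prefix (s : list nat) (j i : nat) : bool :=
  existsb (Nat.eqb i) (firstn j s).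

Lemma prefix_nth (s : list nat) (j m : nat) :
  NoDup s -> (m < length s)%nat -> prefix s j (nth m s 0%nat) = Nat.ltb m j.
Proof.
  intros Hnd; revert j m; induction Hnd as [|a s Ha Hnd IH]; intros j m Hm;
    cbn in Hm; [lia|].
  destruct j as [|j]; [reflexivity|]; destruct m as [|m]; unfold prefix in *;
    cbn [firstn existsb nth].
  - now rewrite Nat.eqb_refl.
  - change (Nat.ltb (S m) (S j)) with (Nat.ltb m j); rewrite <- IH by lia.
    destruct (Nat.eqb_spec (nth m s 0%nat) a) as [<-|]; [|reflexivity].
    exfalso; apply Ha, nth_In; lia.
Qed.

Definition vertex (L : list nat) (x : nat) (s : list nat) (j : nat) : nat :=
  ((x + psum L s j) mod list_sum L)%nat.

Lemma in_tonn_max_simplex (L : list nat) (x : nat) (s : list nat) (v : nat) :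
  In v (tonn_max_simplex (list_sum L) L x s) <->
  exists j, (j < length L)%nat /\ v = vertex L x s j.
Proof.
  unfold tonn_max_simplex; rewrite in_map_iff; split.
  - intros (j & <- & Hj); apply in_seq in Hj; exists j; split; [lia|auto].
  - intros (j & Hj & ->); exists j; split; [auto | apply in_seq; lia].
Qed.

Section Simplex.

Context {L s : list nat} {x : nat} (Hgen : generic L)
  (Hpos : forall i, (i < length L)%nat -> (0 < lval L i)%nat)
  (Hs : Permutation s (seq 0 (length L))).

Lemma perm_length : length s = length L.
Proof. now rewrite (Permutation_length Hs), length_seq. Qed.

Lemma perm_nth_lt (m : nat) : (m < length L)%nat -> (nth m s 0 < length L)%nat.
Proof.
  rewrite <- perm_length at 1; intros Hm.
  apply (nth_In s 0%nat), (Permutation_in _ Hs), in_seq in Hm; lia.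
Qed.

Lemma perm_nth_ind (Q : nat -> Prop) :
  (forall m, (m < length L)%nat -> Q (nth m s 0%nat)) ->
  forall i, (i < length L)%nat -> Q i.
Proof.
  intros HQ i Hi.
  assert (Hin : In i s).
  { apply (Permutation_in _ (Permutation_sym Hs)), in_seq; lia. }
  apply (In_nth s i 0%nat) in Hin as (m & Hm & <-).
  apply HQ; now rewrite <- perm_length.
Qed.

Lemma prefix_perm_nth (j m : nat) :
  (m < length L)%nat -> prefix s j (nth m s 0%nat) = Nat.ltb m j.
Proof.
  intros Hm; apply prefix_nth; [|now rewrite perm_length].
  apply (Permutation_NoDup (Permutation_sym Hs)), seq_NoDup.
Qed.

Lemma weight_prefix (j : nat) :
  weight L (fun i => b2R (prefix s j i)) = INR (psum L s j).
Proof.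
  unfold dot, psum; rewrite (rsum_permutation _ s _ Hs).
  rewrite <- firstn_map, INR_list_sum_firstn, length_map, perm_length.
  apply rsum_ext; intros m Hm; rewrite prefix_perm_nth by auto.
  rewrite (nth_indep (map (lval L) s) 0%nat (lval L 0)), map_nth; [reflexivity|].
  now rewrite length_map, perm_length.
Qed.

Lemma psum_full : psum L s (length L) = list_sum L.
Proof.
  apply INR_eq; rewrite <- weight_prefix, <- weight_one; apply dot_ext, perm_nth_ind.
  intros m Hm; now rewrite prefix_perm_nth, (proj2 (Nat.ltb_lt _ _) Hm).
Qed.

Lemma psum_lt (u w : nat) :
  (u < w <= length L)%nat -> (psum L s u < psum L s w)%nat.
Proof.
  intros Huw; unfold psum; rewrite <- !firstn_map.
  apply list_sum_firstn_lt; [|now rewrite length_map, perm_length].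
  intros a (i & <- & Hi)%in_map_iff; apply Hpos.
  apply (Permutation_in _ Hs), in_seq in Hi; lia.
Qed.

Lemma psum_lt_full (u : nat) : (u < length L)%nat -> (psum L s u < list_sum L)%nat.
Proof. intros Hu; rewrite <- psum_full; apply psum_lt; lia. Qed.

Lemma vertex_lt (j : nat) : (0 < list_sum L)%nat -> (vertex L x s j < list_sum L)%nat.
Proof. intros; apply Nat.mod_upper_bound; lia. Qed.

Lemma INR_vertex (j : nat) : exists q : Z,
  INR (vertex L x s j) = INR x + INR (psum L s j) - IZR q * INR (list_sum L).
Proof.
  exists (Z.of_nat ((x + psum L s j) / list_sum L)); rewrite <- INR_IZR_INZ.
  pose proof (f_equal INR (Nat.div_mod_eq (x + psum L s j) (list_sum L))) as Hdiv.
  rewrite !plus_INR, mult_INR in Hdiv; unfold vertex; lra.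
Qed.

(* When [u < w] the path from the vertex [w] to the vertex [u] wraps around the cyclic
   order, hence the extra [1]. *)
Lemma subset_of_vertex_sub (u w i : nat) :
  (u < length L)%nat -> (w < length L)%nat -> (i < length L)%nat ->
  b2R (subset_of L
    ((vertex L x s u + list_sum L - vertex L x s w) mod list_sum L) i) =
  b2R (prefix s u i) - b2R (prefix s w i) + b2R (Nat.ltb u w).
Proof.
  intros Hu Hw Hi.
  pose (I := fun i => if Nat.ltb u w
                      then negb (prefix s w i && negb (prefix s u i))
                      else (prefix s u i && negb (prefix s w i))%bool).
  assert (HI : forall i, (i < length L)%nat -> b2R (I i) =
            b2R (prefix s u i) - b2R (prefix s w i) + b2R (Nat.ltb u w)).
  { apply perm_nth_ind; intros m Hm; unfold I; rewrite !prefix_perm_nth by auto.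
    destruct (Nat.ltb_spec u w), (Nat.ltb_spec m u), (Nat.ltb_spec m w);
      cbn [b2R negb andb]; lra || lia. }
  assert (Hsum : (subsum L I + psum L s w
                  = psum L s u + Nat.b2n (Nat.ltb u w) * list_sum L)%nat).
  { apply INR_eq; rewrite !plus_INR, mult_INR, <- weight_b2R, <- weight_one.
    rewrite (dot_ext _ _ _ _ HI), dot_plus, dot_minus, dot_const, !weight_prefix.
    destruct (Nat.ltb u w); cbn [b2R Nat.b2n INR]; ring. }
  pose proof (psum_lt_full u Hu).
  assert (Hlt : (subsum L I < list_sum L)%nat).
  { destruct (Nat.ltb_spec u w); cbn [Nat.b2n] in Hsum; [|lia].
    assert (psum L s u < psum L s w)%nat by (apply psum_lt; auto; lia); lia. }
  unfold vertex; rewrite (mod_sub_mod _ _ _ (Nat.b2n (Nat.ltb u w)) _ Hlt) by lia.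
  rewrite subset_of_subsum by auto; now apply HI.
Qed.

Lemma vertex_inj (u w : nat) :
  (u < length L)%nat -> (w < length L)%nat -> vertex L x s u = vertex L x s w -> u = w.
Proof.
  assert (Hne : forall u w, (w < u < length L)%nat -> vertex L x s u <> vertex L x s w).
  { clear u w; intros u w Huw Heq.
    pose proof (psum_lt w u ltac:(lia)); pose proof (psum_lt_full u ltac:(lia)).
    assert (Hr : ((vertex L x s u + list_sum L - vertex L x s w) mod list_sum L
                  = psum L s u - psum L s w)%nat).
    { apply (mod_sub_mod _ _ _ 0); lia. }
    rewrite Heq, Nat.add_comm, Nat.add_sub, Nat.Div0.mod_same in Hr; lia. }
  intros Hu Hw Heq; destruct (Nat.lt_trichotomy u w) as [Huw|[Huw|Huw]]; auto.
  - exfalso; apply (Hne w u); auto.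
  - exfalso; apply (Hne u w); auto.
Qed.

End Simplex.

(** * Barycentric coordinates and lifts to R^k *)

Record barycentric (L : list nat) (x : nat) (s : list nat) (t p : nat -> R) : Prop := {
  barycentric_base : (x < list_sum L)%nat;
  barycentric_perm : Permutation s (seq 0 (length L));
  barycentric_nonneg : forall j, (j < length L)%nat -> 0 <= t j;
  barycentric_sum : rsum (length L) t = 1;
  barycentric_eq : forall v,
    p v = rsum (length L) (fun j => b2R (Nat.eqb v (vertex L x s j)) * t j)
}.

Arguments barycentric_perm {L x s t p}.
Arguments barycentric_sum {L x s t p}.

Section Barycentric.

Context {L s : list nat} {x : nat} {t p : nat -> R} (Hp : barycentric L x s t p).

Lemma barycentric_length_pos : (0 < length L)%nat.
Proof. destruct Hp as [Hx _ _ _ _]; destruct L; cbn in *; lia. Qed.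

Lemma barycentric_rsum (F : nat -> R) :
  rsum (list_sum L) (fun v => p v * F v) =
  rsum (length L) (fun j => t j * F (vertex L x s j)).
Proof.
  destruct Hp as [Hx _ _ _ Heq].
  rewrite (rsum_ext _ _ (fun v => rsum (length L) (fun j =>
    t j * (b2R (Nat.eqb v (vertex L x s j)) * F v)))).
  - rewrite rsum_swap; apply rsum_ext; intros j _.
    rewrite rsum_scal, rsum_delta; [reflexivity | apply vertex_lt; lia].
  - intros v _; rewrite Heq, Rmult_comm, <- rsum_scal.
    apply rsum_ext; intros; ring.
Qed.

Lemma barycentric_vertex_ge (m : nat) :
  (m < length L)%nat -> t m <= p (vertex L x s m).
Proof.
  destruct Hp as [_ _ Ht _ Heq]; intros Hm; rewrite Heq.
  eapply Rle_trans; [|apply rsum_term_le; [|exact Hm]].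
  - cbv beta; rewrite Nat.eqb_refl; cbn; lra.
  - intros j Hj; apply Rmult_le_pos; [apply b2R_bounds | auto].
Qed.

Lemma barycentric_support (v : nat) :
  p v <> 0 -> exists j, (j < length L)%nat /\ v = vertex L x s j.
Proof.
  destruct Hp as [_ _ _ _ Heq]; intros Hv; rewrite Heq in Hv.
  apply rsum_neq0_exists in Hv as (j & Hj & Hne); exists j; split; [exact Hj|].
  destruct (Nat.eqb_spec v (vertex L x s j)) as [Hvj|Hvj]; [exact Hvj|].
  exfalso; apply Hne; cbn; ring.
Qed.

Lemma tonn_realization_of_barycentric : tonn_realization (list_sum L) L p.
Proof.
  pose proof Hp as [Hx Hs Ht Hsum Heq]; repeat split.
  - intros v; rewrite Heq; apply rsum_nonneg; intros j Hj.
    apply Rmult_le_pos; [apply b2R_bounds | auto].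
  - intros v Hv; apply NNPP; intros Hne.
    apply barycentric_support in Hne as (j & _ & ->).
    pose proof (@vertex_lt L s x j); lia.
  - fold (rsum (list_sum L) p); rewrite <- Hsum.
    rewrite (rsum_ext _ p (fun v => p v * 1)) by (intros; ring).
    rewrite (barycentric_rsum (fun _ => 1)); apply rsum_ext; intros; ring.
  - exists x, s; repeat split; auto; intros v Hv; apply in_tonn_max_simplex.
    now apply barycentric_support.
Qed.

End Barycentric.

Lemma barycentric_of_tonn_realization (L : list nat) (p : nat -> R) :
  (forall i, (i < length L)%nat -> (0 < lval L i)%nat) ->
  tonn_realization (list_sum L) L p -> exists x s t, barycentric L x s t p.
Proof.
  intros Hpos (Hge & _ & Hsum & x & s & Hx & Hs & Hsupp).
  assert (Heq : forall v, p v = rsum (length L) (fun j =>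
            b2R (Nat.eqb v (vertex L x s j)) * p (vertex L x s j))).
  { intros v; rewrite (rsum_ext _ _ (fun j => b2R (Nat.eqb v (vertex L x s j)) * p v)).
    2: { intros j _; destruct (Nat.eqb_spec v (vertex L x s j)) as [<-|]; cbn; ring. }
    destruct (Req_dec (p v) 0) as [Hv|Hv].
    - rewrite Hv, (rsum_ext _ _ (fun _ => 0)) by (intros; ring).
      symmetry; apply rsum_zero.
    - apply Hsupp, in_tonn_max_simplex in Hv as (m & Hm & ->).
      rewrite <- (rsum_delta _ m (fun _ => p (vertex L x s m)) Hm) at 1.
      apply rsum_ext; intros j Hj; f_equal; f_equal.
      apply Bool.eq_true_iff_eq; rewrite !Nat.eqb_eq; split; [now intros ->|].
      intros Hmj; symmetry; now apply (vertex_inj (x := x) Hpos Hs). }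
  exists x, s, (fun j => p (vertex L x s j)); split; auto.
  rewrite <- Hsum; fold (rsum (list_sum L) p).
  rewrite (rsum_ext (list_sum L) p _ (fun v _ => Heq v)), rsum_swap.
  apply rsum_ext; intros j _.
  rewrite (rsum_delta _ (vertex L x s j) (fun _ => p (vertex L x s j))); [reflexivity|].
  apply vertex_lt; lia.
Qed.

Lemma tonn_realization_pos_exists (n : nat) (L : list nat) (p : nat -> R) :
  tonn_realization n L p -> exists b, (b < n)%nat /\ 0 < p b.
Proof.
  intros (Hge & _ & Hsum & _).
  destruct (rsum_neq0_exists n p) as (b & Hbn & Hb); [unfold rsum; lra|].
  exists b; specialize (Hge b); split; [exact Hbn | lra].
Qed.

(* The point of R^k with barycentric coordinates [p], the vertex [v] being lifted
   to [b X] plus the indicator vector of the set of steps leading from [b] to [v];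
   here [X] is an integral vector with [l.X = 1]. *)
Definition lift (L : list nat) (X : nat -> R) (b : nat) (p : nat -> R) (i : nat) : R :=
  INR b * X i + rsum (list_sum L) (fun v =>
    p v * b2R (subset_of L ((v + list_sum L - b) mod list_sum L) i)).

Lemma lift_bounds (L : list nat) (X p : nat -> R) (v i : nat) :
  generic L -> (i < length L)%nat -> tonn_realization (list_sum L) L p ->
  (v < list_sum L)%nat ->
  0 <= lift L X v p i - INR v * X i <= 1 - p v.
Proof.
  intros Hgen Hi (Hge & _ & Hsum & _) Hv; fold (rsum (list_sum L) p) in Hsum.
  unfold lift; rewrite Rplus_minus_l; split.
  - apply rsum_nonneg; intros u _; apply Rmult_le_pos; [auto | apply b2R_bounds].
  - rewrite <- Hsum, <- (rsum_delta _ v p Hv), <- rsum_minus at 1.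
    apply rsum_le; intros u _; destruct (Nat.eqb_spec u v) as [->|_].
    + rewrite Nat.add_comm, Nat.add_sub, Nat.Div0.mod_same.
      rewrite subset_of_zero by auto; cbn; lra.
    + pose proof (b2R_bounds (subset_of L ((u + list_sum L - v) mod list_sum L) i)).
      specialize (Hge u); cbn; nra.
Qed.

(* The point with barycentric coordinates [t] in the simplex of R^k spanned by [x X],
   [x X + e_s(1)], [x X + e_s(1) + e_s(2)], ... *)
Definition simplex_point (L : list nat) (X : nat -> R) (x : nat) (s : list nat)
    (t : nat -> R) (i : nat) : R :=
  INR x * X i + rsum (length L) (fun j => t j * b2R (prefix s j i)).

Lemma simplex_point_nth (L s : list nat) (X : nat -> R) (x : nat) (t : nat -> R)
    (m : nat) :
  Permutation s (seq 0 (length L)) -> (m < length L)%nat ->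
  simplex_point L X x s t (nth m s 0%nat) =
  INR x * X (nth m s 0%nat) + tail_sum (length L) t m.
Proof.
  intros Hs Hm; unfold simplex_point; f_equal.
  apply rsum_ext; intros j _; now rewrite (prefix_perm_nth Hs).
Qed.

Lemma barycentric_lower_bound (L s : list nat) (X : nat -> R) (x : nat)
    (t p : nat -> R) (v : nat) (d : nat -> Z) (r : R) :
  barycentric L x s t p -> (v < list_sum L)%nat -> r < 1 ->
  weight L (fun i => IZR (d i)) = INR v - INR x ->
  (forall i i', (i < length L)%nat -> (i' < length L)%nat ->
     (simplex_point L X x s t i - INR x * X i - IZR (d i))
     - (simplex_point L X x s t i' - INR x * X i' - IZR (d i')) <= r) ->
  1 - r <= p v.
Proof.
  intros Hp Hv Hr Hd Hosc; pose proof Hp as [Hx Hs Ht Hsum _].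
  pose proof (barycentric_length_pos Hp) as Hk.
  destruct (tail_sum_osc (length L) t (fun m => d (nth m s 0%nat)) r)
    as (m & Hm & Htm & Hdrop); auto.
  { intros m m' Hm Hm'.
    pose proof (Hosc _ _ (perm_nth_lt Hs m Hm) (perm_nth_lt Hs m' Hm')) as Hmm'.
    rewrite !simplex_point_nth in Hmm' by auto; lra. }
  set (e := d (nth (length L - 1) s 0%nat)) in *.
  replace v with (vertex L x s m).
  { eapply Rle_trans; [exact Htm | now apply barycentric_vertex_ge]. }
  assert (Hdw : weight L (fun i => IZR (d i))
                = IZR e * INR (list_sum L) + INR (psum L s m)).
  { rewrite <- weight_one, <- dot_const, <- (weight_prefix Hs), <- dot_plus.
    apply dot_ext, (perm_nth_ind Hs); intros j Hj.
    now rewrite Hdrop, (prefix_perm_nth Hs). }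
  rewrite Hd, !INR_IZR_INZ, <- mult_IZR, <- plus_IZR, <- minus_IZR in Hdw.
  apply eq_IZR in Hdw; apply Nat2Z.inj; unfold vertex; rewrite Nat2Z.inj_mod.
  symmetry; apply (Z.mod_unique_pos _ _ (- e)); lia.
Qed.

(* The lattice [K], before passing to the quotient by [(1,...,1)]. *)
Definition lattice_point (L : list nat) (z : nat -> R) : Prop :=
  (forall i, (i < length L)%nat -> is_int (z i)) /\
  exists m, weight L z = IZR m * INR (list_sum L).

Section Lattice.

Context (L : list nat) (X : nat -> R)
  (Hpos : forall i, (i < length L)%nat -> (0 < lval L i)%nat)
  (HX : forall i, is_int (X i)) (HX1 : weight L X = 1).

Lemma lift_vertex (x : nat) (s : list nat) (t p : nat -> R) (w : nat) :
  generic L -> barycentric L x s t p -> (w < length L)%nat ->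
  exists z r, lattice_point L z /\ forall i, (i < length L)%nat ->
    lift L X (vertex L x s w) p i = simplex_point L X x s t i + z i + r.
Proof.
  intros Hgen Hp Hw; pose proof (barycentric_perm Hp) as Hs.
  exists (fun i => (INR (vertex L x s w) - INR x) * X i - b2R (prefix s w i)).
  exists (rsum (length L) (fun j => t j * b2R (Nat.ltb j w))); split; [split|].
  - intros i _; apply is_int_minus; [|apply is_int_b2R].
    apply is_int_mult; [apply is_int_minus; apply is_int_INR | apply HX].
  - destruct (@INR_vertex L s x w) as [q Hq]; exists (- q)%Z.
    rewrite dot_minus, dot_scal, HX1, (weight_prefix Hs), Hq, opp_IZR; ring.
  - intros i Hi; unfold lift, simplex_point; rewrite (barycentric_rsum Hp).
    rewrite (rsum_ext _ _ (fun j => (t j * b2R (prefix s j i)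
      - b2R (prefix s w i) * t j) + t j * b2R (Nat.ltb j w))).
    + rewrite rsum_plus, rsum_minus, rsum_scal, (barycentric_sum Hp); ring.
    + intros j Hj; rewrite subset_of_vertex_sub by auto; ring.
Qed.

Lemma lattice_point_base_exists (w : nat -> R) :
  (0 < list_sum L)%nat -> (forall i, is_int (w i)) ->
  exists x, (x < list_sum L)%nat /\ lattice_point L (fun i => INR x * X i - w i).
Proof.
  intros Hn Hw.
  destruct (is_int_dot (length L) (fun i => INR (lval L i)) w) as [W HW]; auto.
  { intros; apply is_int_INR. }
  pose proof (Z.mod_pos_bound W (Z.of_nat (list_sum L)) ltac:(lia)).
  exists (Z.to_nat (W mod Z.of_nat (list_sum L))); split; [lia|split].
  - intros i _; apply is_int_minus; [|apply Hw].
    apply is_int_mult; [apply is_int_INR | apply HX].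
  - exists (- (W / Z.of_nat (list_sum L)))%Z.
    rewrite dot_minus, dot_scal, HX1, HW, !INR_IZR_INZ, Z2Nat.id by lia.
    rewrite Z.mod_eq, minus_IZR, mult_IZR, opp_IZR by lia; ring.
Qed.

Lemma simplex_point_covers (h : nat -> R) :
  (0 < length L)%nat ->
  exists x s t p z r, barycentric L x s t p /\ lattice_point L z /\
    forall i, (i < length L)%nat -> simplex_point L X x s t i = h i + z i + r.
Proof.
  intros Hk.
  destruct (lattice_point_base_exists (fun i => IZR (Int_part (h i))))
    as (x & Hx & Hz); [now apply list_sum_pos | intros; apply is_int_IZR |].
  destruct (exists_StronglySorted nat (fun a b => frac_part (h b) <= frac_part (h a))
              (seq 0 (length L))) as (s & Hs & Hsort); [intros; lra..|].
  pose (rho := fun m => frac_part (h (nth m s 0%nat))).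
  pose (t := gaps (length L) rho).
  exists x, s, t.
  exists (fun v => rsum (length L) (fun j => b2R (Nat.eqb v (vertex L x s j)) * t j)).
  exists (fun i => INR x * X i - IZR (Int_part (h i))), (- rho (length L - 1)%nat).
  split; [split; auto|split; [exact Hz|]].
  - intros j Hj; apply gaps_nonneg; [| |exact Hj].
    + intros m Hm; apply (StronglySorted_nth_S _ _ 0%nat s m Hsort).
      now rewrite (perm_length Hs).
    + pose proof (base_fp (h (nth 0 s 0%nat))).
      pose proof (base_fp (h (nth (length L - 1) s 0%nat))); unfold rho; lra.
  - now apply rsum_gaps.
  - apply (perm_nth_ind Hs); intros m Hm; unfold t.
    rewrite simplex_point_nth, tail_sum_gaps by auto; unfold rho at 1, frac_part.
    ring.
Qed.

End Lattice.

(** * The map to the torus *)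

Section TorusMap.

Context (L : list nat) (C E : nat -> nat -> R) (Hk : (0 < length L)%nat)
  (Hgen : generic L)
  (Hpos : forall i, (i < length L)%nat -> (0 < lval L i)%nat)
  (HCE : dual_bases (length L) C E)
  (HC0 : forall i, INR (lval L i) = C 0%nat i).

Lemma INR_list_sum_neq0 : INR (list_sum L) <> 0.
Proof. pose proof (list_sum_pos L Hk Hpos); apply not_0_INR; lia. Qed.

Lemma weight_dual (j : nat) :
  (j < length L)%nat -> weight L (E j) = b2R (Nat.eqb 0 j).
Proof.
  intros Hj; rewrite <- (dual_bases_dot HCE) by auto.
  apply rsum_ext; intros; now rewrite HC0.
Qed.

Lemma weight_E0 : weight L (E 0%nat) = 1.
Proof. now rewrite weight_dual. Qed.

(* The form [C (S j)] corrected by a multiple of [L] so as to vanish on (1,...,1). *)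
Definition torus_form (j i : nat) : R :=
  C (S j) i - dot (length L) (C (S j)) (fun _ => 1) / INR (list_sum L) * INR (lval L i).

Definition torus_coords (x : nat -> R) (j : nat) : R := dot (length L) (torus_form j) x.

Lemma torus_coords_eq (x : nat -> R) (j : nat) :
  torus_coords x j =
  dot (length L) (C (S j)) (fun i => x i - weight L x / INR (list_sum L)).
Proof.
  unfold torus_coords, torus_form; rewrite dot_comm, dot_minus, dot_scal.
  rewrite dot_minus, (dot_const _ _ (weight L x / _)), !(dot_comm _ x).
  field; apply INR_list_sum_neq0.
Qed.

Lemma torus_coords_const (a : R) (j : nat) : torus_coords (fun _ => a) j = 0.
Proof.
  rewrite torus_coords_eq, (dot_const _ (fun i => INR (lval L i)) a), weight_one.
  rewrite (dot_ext _ _ _ (fun _ => 0)); [rewrite dot_const; ring|].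
  intros; field; apply INR_list_sum_neq0.
Qed.

Lemma torus_coords_lattice_point (z : nat -> R) (j : nat) :
  lattice_point L z -> is_int (torus_coords z j).
Proof.
  intros [Hz [m Hm]]; rewrite torus_coords_eq, Hm; apply is_int_dot.
  - intros i _; apply (dual_bases_is_int_form HCE).
  - intros i Hi; apply is_int_minus; [auto|].
    exists m; field; apply INR_list_sum_neq0.
Qed.

Lemma torus_coords_shift (x y z : nat -> R) (r : R) (j : nat) :
  lattice_point L z -> (forall i, (i < length L)%nat -> x i = y i + z i + r) ->
  is_int (torus_coords x j - torus_coords y j).
Proof.
  intros Hz Hx; replace (torus_coords x j) with
    (torus_coords y j + torus_coords z j + torus_coords (fun _ => r) j).
  - rewrite torus_coords_const.
    replace (_ - _) with (torus_coords z j) by ring.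
    now apply torus_coords_lattice_point.
  - unfold torus_coords; rewrite <- !dot_plus; symmetry; now apply dot_ext.
Qed.

Lemma torus_coords_dual (m j : nat) :
  (m < length L - 1)%nat -> (j < length L - 1)%nat ->
  torus_coords (E (S m)) j = b2R (Nat.eqb m j).
Proof.
  intros Hm Hj; rewrite torus_coords_eq, weight_dual by lia; cbn [Nat.eqb b2R].
  rewrite dot_minus, dot_const, (dual_bases_dot HCE) by lia.
  cbn [Nat.eqb]; rewrite Nat.eqb_sym; field; apply INR_list_sum_neq0.
Qed.

Lemma torus_coords_surj (y : nat -> R) :
  exists h, forall j, (j < length L - 1)%nat -> torus_coords h j = y j.
Proof.
  exists (fun i => rsum (length L - 1) (fun m => y m * E (S m) i)); intros j Hj.
  unfold torus_coords; rewrite dot_rsum, <- (rsum_delta (length L - 1) j y Hj).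
  apply rsum_ext; intros m Hm; rewrite <- torus_coords_dual by auto.
  apply Rmult_comm.
Qed.

Lemma torus_coords_expansion (x : nat -> R) (i : nat) :
  (i < length L)%nat ->
  x i = weight L x / INR (list_sum L)
        + rsum (length L - 1) (fun j => torus_coords x j * E (S j) i).
Proof.
  intros Hi; pose (y := fun i => x i - weight L x / INR (list_sum L)).
  assert (Hy0 : dot (length L) (C 0%nat) y = 0).
  { transitivity (weight L y).
    - apply rsum_ext; intros; now rewrite HC0.
    - unfold y; rewrite dot_minus, dot_const, weight_one.
      field; apply INR_list_sum_neq0. }
  pose proof (dual_bases_expansion HCE y i Hi) as Hexp.
  rewrite rsum_pred, Hy0, Rmult_0_l, Rplus_0_l in Hexp by exact Hk.
  rewrite (rsum_ext _ _ (fun j => dot (length L) (C (S j)) y * E (S j) i)).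
  - rewrite <- Hexp; unfold y; ring.
  - intros; now rewrite torus_coords_eq.
Qed.

Definition basis_norm : R :=
  rsum (length L) (fun i => rsum (length L - 1) (fun j => Rabs (E (S j) i))).

Lemma basis_norm_nonneg : 0 <= basis_norm.
Proof. apply rsum_nonneg; intros; apply rsum_nonneg; intros; apply Rabs_pos. Qed.

Lemma torus_coords_near_int (x : nat -> R) (e : R) :
  0 <= e ->
  (forall j, (j < length L - 1)%nat ->
     exists z, Rabs (torus_coords x j - IZR z) <= e) ->
  exists w r, (forall i, is_int (w i)) /\ weight L w = 0 /\
    forall i, (i < length L)%nat -> Rabs (x i - w i - r) <= e * basis_norm.
Proof.
  intros He Hnear.
  destruct (choice (fun j z => (j < length L - 1)%nat ->
    Rabs (torus_coords x j - IZR z) <= e)) as [z Hz].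
  { intros j; destruct (Nat.lt_ge_cases j (length L - 1)) as [Hj|Hj].
    - destruct (Hnear j Hj) as [z Hz]; now exists z.
    - exists 0%Z; lia. }
  exists (fun i => rsum (length L - 1) (fun j => IZR (z j) * E (S j) i)).
  exists (weight L x / INR (list_sum L)); repeat split.
  - intros i; apply is_int_rsum; intros j _.
    apply is_int_mult; [apply is_int_IZR | apply (dual_bases_is_int_vector HCE)].
  - rewrite dot_rsum, (rsum_ext _ _ (fun _ => 0)); [apply rsum_zero|].
    intros j Hj; rewrite weight_dual by lia; apply Rmult_0_r.
  - intros i Hi; replace (x i - _ - _) with
      (rsum (length L - 1) (fun j => (torus_coords x j - IZR (z j)) * E (S j) i)).
    + eapply Rle_trans; [apply rsum_mult_Rabs_le, Hz|].
      apply Rmult_le_compat_l; [exact He|].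
      apply (rsum_term_le _ i (fun i => rsum _ (fun j => Rabs (E (S j) i)))); [|auto].
      intros; apply rsum_nonneg; intros; apply Rabs_pos.
    + rewrite (rsum_ext _ _ (fun j => torus_coords x j * E (S j) i
        - IZR (z j) * E (S j) i)) by (intros; ring).
      pose proof (torus_coords_expansion x i Hi); rewrite rsum_minus; lra.
Qed.

Definition torus_map (p : nat -> R) : nat -> R :=
  torus_point (length L - 1)
    (torus_coords (lift L (E 0%nat) (epsilon (inhabits 0%nat) (fun b => p b <> 0)) p)).

Lemma torus_point_lift_simplex_point (x : nat) (s : list nat) (t p : nat -> R)
    (b u : nat) :
  barycentric L x s t p -> p b <> 0 ->
  torus_point (length L - 1) (torus_coords (lift L (E 0%nat) b p)) u =
  torus_point (length L - 1) (torus_coords (simplex_point L (E 0%nat) x s t)) u.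
Proof.
  intros Hp Hb; destruct (barycentric_support Hp b Hb) as (w & Hw & ->).
  destruct (lift_vertex L (E 0%nat) Hpos (dual_bases_is_int_vector HCE 0%nat)
              weight_E0 x s t p w Hgen Hp Hw) as (z & r & Hz & Heq).
  apply torus_point_shift_int; intros j _; now apply (torus_coords_shift _ _ z r).
Qed.

Lemma torus_map_simplex_point (x : nat) (s : list nat) (t p : nat -> R) (u : nat) :
  barycentric L x s t p ->
  torus_map p u =
  torus_point (length L - 1) (torus_coords (simplex_point L (E 0%nat) x s t)) u.
Proof.
  intros Hp; apply torus_point_lift_simplex_point; [exact Hp|].
  apply (epsilon_spec (inhabits 0%nat) (fun b => p b <> 0)).
  destruct (tonn_realization_pos_exists _ _ _ (tonn_realization_of_barycentric Hp))
    as (b & _ & Hb); exists b; lra.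
Qed.

Lemma torus_map_lift (p : nat -> R) (b u : nat) :
  tonn_realization (list_sum L) L p -> p b <> 0 ->
  torus_map p u = torus_point (length L - 1) (torus_coords (lift L (E 0%nat) b p)) u.
Proof.
  intros Hreal Hb.
  destruct (barycentric_of_tonn_realization L p Hpos Hreal) as (x & s & t & Hp).
  rewrite (torus_map_simplex_point x s t p u Hp); symmetry.
  now apply torus_point_lift_simplex_point.
Qed.

Lemma torus_coords_lift_lipschitz (b : nat) : exists M, 0 <= M /\
  forall p q e j, 0 <= e ->
    (forall v, (v < list_sum L)%nat -> Rabs (q v - p v) <= e) ->
    (j < length L - 1)%nat ->
    Rabs (torus_coords (lift L (E 0%nat) b q) j
          - torus_coords (lift L (E 0%nat) b p) j) <= e * M.
Proof.
  pose (steps := fun v i =>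
    b2R (subset_of L ((v + list_sum L - b) mod list_sum L) i)).
  pose (norm := fun j => rsum (list_sum L) (fun v => Rabs (torus_coords (steps v) j))).
  assert (Hnorm : forall j, 0 <= norm j).
  { intros j; apply rsum_nonneg; intros; apply Rabs_pos. }
  exists (rsum (length L - 1) norm); split; [now apply rsum_nonneg|].
  intros p q e j He Hpq Hj; unfold torus_coords; rewrite <- dot_minus.
  rewrite (dot_ext _ _ _ (fun i => rsum (list_sum L) (fun v =>
    (q v - p v) * steps v i))).
  - rewrite dot_rsum; apply Rle_trans with (e * norm j).
    + now apply rsum_mult_Rabs_le.
    + apply Rmult_le_compat_l; [exact He | now apply (rsum_term_le _ j norm)].
  - intros i _; unfold lift; rewrite (rsum_ext _ (fun v => (q v - p v) * _)
      (fun v => q v * steps v i - p v * steps v i)) by (intros; ring).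
    rewrite rsum_minus; unfold steps; ring.
Qed.

Lemma torus_map_continuous :
  continuous_on (list_sum L) (2 * (length L - 1)) (tonn_realization (list_sum L) L)
    torus_map.
Proof.
  intros p Hp eps Heps.
  destruct (tonn_realization_pos_exists _ _ _ Hp) as (b & Hbn & Hb).
  destruct (torus_coords_lift_lipschitz b) as (M & HM & Hlip).
  assert (HPI := PI_RGT_0).
  assert (HD : 0 < 2 * PI * M + 1) by nra.
  set (e := eps / (2 * PI * M + 1)).
  assert (He : 0 < e) by now apply Rdiv_lt_0_compat.
  exists (Rmin (p b) e); split; [now apply Rmin_glb_lt|].
  intros q Hq Hclose u Hu.
  assert (Hqb : q b <> 0).
  { specialize (Hclose b Hbn); intros Hqb; rewrite Hqb in Hclose.
    pose proof (Rmin_l (p b) e); apply Rabs_def2 in Hclose; lra. }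
  rewrite (torus_map_lift p b), (torus_map_lift q b) by (auto; lra).
  apply Rle_lt_trans with (2 * PI * (e * M)).
  - apply torus_point_lipschitz; [|exact Hu].
    intros j Hj; apply Hlip; [lra | | exact Hj].
    intros v Hv; specialize (Hclose v Hv); pose proof (Rmin_r (p b) e); lra.
  - assert (e * (2 * PI * M + 1) = eps) by (unfold e; field; lra); nra.
Qed.

Lemma torus_map_surj (q : nat -> R) :
  torus (length L - 1) q ->
  exists p, tonn_realization (list_sum L) L p /\ forall u, torus_map p u = q u.
Proof.
  intros Hq; destruct (torus_point_surj _ _ Hq) as [y Hy].
  destruct (torus_coords_surj y) as [h Hh].
  destruct (simplex_point_covers L (E 0%nat) Hpos (dual_bases_is_int_vector HCE 0%nat)
              weight_E0 h Hk) as (x & s & t & p & z & r & Hp & Hz & Heq).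
  exists p; split; [exact (tonn_realization_of_barycentric Hp)|].
  intros u; rewrite (torus_map_simplex_point x s t p u Hp), <- Hy.
  apply torus_point_shift_int; intros j Hj; rewrite <- Hh by exact Hj.
  now apply (torus_coords_shift _ _ z r).
Qed.

Lemma coordinate_le_of_torus_coords_near (p p' : nat -> R) (x : nat) (s : list nat)
    (t : nat -> R) (v : nat) (e : R) :
  tonn_realization (list_sum L) L p -> barycentric L x s t p' ->
  (v < list_sum L)%nat -> 0 <= e ->
  (forall j, (j < length L - 1)%nat -> exists z,
     Rabs (torus_coords (lift L (E 0%nat) v p) j
           - torus_coords (simplex_point L (E 0%nat) x s t) j - IZR z) <= e) ->
  p v <= p' v + 2 * (e * basis_norm).
Proof.
  intros Hp Hp' Hv He Hclose.
  destruct (Rle_lt_dec (p v) (2 * (e * basis_norm))) as [Hsmall|Hlarge].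
  { pose proof (proj1 (tonn_realization_of_barycentric Hp') v); lra. }
  pose (y := fun i => lift L (E 0%nat) v p i - simplex_point L (E 0%nat) x s t i).
  destruct (torus_coords_near_int y e He) as (w & r & Hw & Hw0 & Hy).
  { intros j Hj; unfold torus_coords, y; rewrite dot_minus; now apply Hclose. }
  destruct (choice (fun i z => (INR v - INR x) * E 0%nat i - w i = IZR z)) as [d Hd].
  { intros i; apply is_int_minus; [apply is_int_mult|]; auto.
    - apply is_int_minus; apply is_int_INR.
    - apply (dual_bases_is_int_vector HCE). }
  enough (1 - (1 - p v + 2 * (e * basis_norm)) <= p' v) by lra.
  apply (barycentric_lower_bound L s (E 0%nat) x t p' v d); auto; [lra | |].
  - rewrite <- (dot_ext _ _ _ _ (fun i _ => Hd i)), dot_minus, dot_scal, weight_E0, Hw0.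
    ring.
  - intros i i' Hi Hi'; rewrite <- !Hd.
    pose proof (lift_bounds L (E 0%nat) p v i Hgen Hi Hp Hv).
    pose proof (lift_bounds L (E 0%nat) p v i' Hgen Hi' Hp Hv).
    pose proof (Rle_abs (- (y i - w i - r))) as Hyi; rewrite Rabs_Ropp in Hyi.
    pose proof (Rle_abs (y i' - w i' - r)).
    pose proof (Hy i Hi); pose proof (Hy i' Hi'); unfold y in *; lra.
Qed.

Lemma torus_map_inverse_uniform (eps : R) :
  0 < eps -> exists delta, 0 < delta /\ forall p p',
    tonn_realization (list_sum L) L p -> tonn_realization (list_sum L) L p' ->
    (forall u, (u < 2 * (length L - 1))%nat ->
       Rabs (torus_map p u - torus_map p' u) < delta) ->
    forall v, (v < list_sum L)%nat -> Rabs (p v - p' v) < eps.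
Proof.
  intros Heps; pose proof basis_norm_nonneg as HB.
  set (e := eps / (2 * basis_norm + 1)).
  assert (He : 0 < e) by (apply Rdiv_lt_0_compat; lra).
  assert (Hee : e * (2 * basis_norm + 1) = eps) by (unfold e; field; lra).
  destruct (torus_point_close (length L - 1) e He) as (delta & Hdelta & Hclose).
  exists delta; split; [exact Hdelta|].
  assert (Hle : forall p p',
            tonn_realization (list_sum L) L p -> tonn_realization (list_sum L) L p' ->
            (forall u, (u < 2 * (length L - 1))%nat ->
               Rabs (torus_map p u - torus_map p' u) < delta) ->
            forall v, (v < list_sum L)%nat -> p v - p' v < eps).
  { intros p p' Hp Hp' Hpp' v Hv; destruct (Req_dec (p v) 0) as [Hv0|Hv0].
    { rewrite Hv0; pose proof (proj1 Hp' v); lra. }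
    destruct (barycentric_of_tonn_realization L p' Hpos Hp') as (x & s & t & Hxst).
    enough (p v <= p' v + 2 * (e * basis_norm)) by lra.
    apply (coordinate_le_of_torus_coords_near p p' x s t); auto; [lra|].
    intros j Hj.
    destruct (Hclose (torus_coords (lift L (E 0%nat) v p))
                (torus_coords (simplex_point L (E 0%nat) x s t))) with (j := j)
      as [z Hz]; [|exact Hj|exists z; lra].
    intros u Hu; rewrite <- torus_map_lift, <- (torus_map_simplex_point x s t p') by auto.
    now apply Hpp'. }
  intros p p' Hp Hp' Hpp' v Hv; apply Rabs_def1; [now apply Hle|].
  enough (p' v - p v < eps) by lra; apply Hle; auto.
  intros u Hu; rewrite Rabs_minus_sym; auto.
Qed.

End TorusMap.

Theorem theorem1p2 (k n : nat) (L : list nat) :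
  (2 <= k)%nat ->
  length L = k ->
  (forall i, (i < k)%nat -> (0 < nth i L 0%nat)%nat) ->
  list_sum L = n ->
  generic L ->
  reduced L ->
  homeomorphic n (2 * (k - 1)) (tonn_realization n L) (torus (k - 1)).
Proof.
  intros Hk <- Hpos <- Hgen Hred.
  assert (Hk0 : (0 < length L)%nat) by lia.
  destruct (dual_bases_exists L Hk0) as (C & E & HCE & HC0).
  rewrite Hred in HC0; setoid_rewrite Rmult_1_l in HC0.
  apply homeomorphic_of_uniform_inverse with (f := torus_map L C E).
  - intros p (_ & Hzero & _); exact Hzero.
  - intros p _; apply torus_torus_point.
  - now apply torus_map_continuous.
  - now apply torus_map_surj.
  - now apply torus_map_inverse_uniform.
Qed.
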